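(* The moduli space $$\mathbf{H}_{2,2}/O(3;\mathbb{R})=\mathbf{H}_{2,3}/O(4;\mathbb{R})=\mathbf{H}_{2,4}/O(5;\mathbb{R})$$ is a singleton set, and $$\mathbf{H}_{2,5}/O(6;\mathbb{R})\cong[0,1].$$
   Context: $\mathcal{Q}_{n-1}=\{[z_0,\ldots,z_n]\in\mathbb{C}P^n: z_0^2+\cdots+z_n^2=0\}$. $Z_d:\mathbb{C}P^1\to\mathbb{C}P^d$ is the rational normal curve $Z_d([u,v])={}^t[u^d,\ldots,\binom di^{1/2}u^{d-i}v^i,\ldots,v^d]$. $\mathbf{H}_{d,n}$ is the set of $2$-spheres $EZ_d$ with $E$ a complex $(n+1)\times(d+1)$ matrix, $E^*E=Id_{d+1}$, and $EZ_d$ lying in $\mathcal{Q}_{n-1}$; these are the holomorphic $2$-spheres of constant curvature and degree $d$ in $\mathcal{Q}_{n-1}$. Two elements of $\mathbf{H}_{d,n}$ are equivalent if one is carried to the other by some $A\in O(n+1;\mathbb{R})$ together with some $SU(2)$-reparametrization of $\mathbb{C}P^1$; $\mathbf{H}_{d,n}/O(n+1;\mathbb{R})$ is the set of equivalence classes. $\mathbf{H}_{d,n}$ is regarded as a subset of $\mathbf{H}_{d,n+1}$ via the natural embedding $\mathbb{C}P^n\subset\mathbb{C}P^{n+1}$ (appending a zero coordinate), and the equalities of moduli spaces are with respect to the maps induced by these inclusions. *)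

(* Defs.v *)
From HB Require Import structures.
From mathcomp Require Import all_boot all_order all_algebra.
From mathcomp Require Import all_classical all_reals all_analysis.
From mathcomp Require Import complex.

Set Implicit Arguments.
Unset Strict Implicit.
Unset Printing Implicit Defensive.

Import Order.TTheory GRing.Theory Num.Theory.
Import numFieldNormedType.Exports.

Local Open Scope classical_set_scope.
Local Open Scope quotient_scope.
Local Open Scope sesquilinear_scope.
Local Open Scope ring_scope.

Definition homeomorphism (X Y : topologicalType) (f : X -> Y) : Prop :=
  continuous f /\
  exists g : Y -> X, [/\ continuous g, cancel f g & cancel g f].

Definition homeomorphic (X Y : topologicalType) : Prop :=
  exists f : X -> Y, homeomorphism f.

(* Typing R[i] as a numClosedFieldType lets the norm topology of an abstract
   numClosedFieldType apply to it. *)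
Definition Cplx (R : realType) : numClosedFieldType := R[i].

Section ProjectiveSpace.
Context {R : realType} {n : nat}.
Local Notation C := (Cplx R).

Definition punctured : set 'cV[C]_n.+1 := [set v | v != 0].

Definition collinear (v w : punctured) : bool :=
  `[< exists2 c : C, c != 0 & val v = c *: val w >].

Lemma collinear_equiv : equiv_class_of collinear.
Proof.
split=> [v|v w|w v u].
- by apply/asboolP; exists 1; rewrite ?oner_neq0 // scale1r.
- apply/asboolP/asboolP => -[c c0 e]; exists c^-1; rewrite ?invr_eq0 //.
    by rewrite e scalerA mulVf // scale1r.
  by rewrite e scalerA mulVf // scale1r.
- move=> /asboolP[c c0 e] /asboolP[b b0 e']; apply/asboolP; exists (c * b).
    by rewrite mulf_neq0.
  by rewrite e e' scalerA.
Qed.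

Canonical collinear_equivRel := EquivRelPack collinear_equiv.

Definition projective_space : Type := quotient_topology {eq_quot collinear}.

Lemma punctured1 : (const_mx 1 : 'cV[C]_n.+1) \in punctured.
Proof.
by apply/mem_set/eqP => /matrixP/(_ 0 0)/eqP; rewrite !mxE oner_eq0.
Qed.

Definition ones : punctured := exist (fun v => v \in punctured) _ punctured1.

(* The point with homogeneous coordinates v; a junk point if v = 0. *)
Definition proj (v : 'cV[C]_n.+1) : projective_space :=
  \pi_projective_space (insubd ones v).

(* Some choice of homogeneous coordinates of p. *)
Definition hvec (p : projective_space) : 'cV[C]_n.+1 := val (repr p).

Lemma hvec_neq0 p : hvec p != 0.
Proof. by have /set_mem := valP (repr p). Qed.

Lemma projK p : proj (hvec p) = p.
Proof. by rewrite /proj /hvec valKd reprK. Qed.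

Lemma proj_scale (c : C) v : c != 0 -> v != 0 -> proj (c *: v) = proj v.
Proof.
move=> c0 v0; rewrite /proj.
have vP : v \in punctured by exact/mem_set.
have cvP : c *: v \in punctured.
  by apply/mem_set; rewrite /punctured /= scaler_eq0 negb_or c0.
apply/eqmodP/asboolP; exists c => //.
by rewrite !insubdK.
Qed.

Lemma hvec_proj v : v != 0 -> exists2 c : C, c != 0 & hvec (proj v) = c *: v.
Proof.
move=> v0; have vP : v \in punctured by exact/mem_set.
have /eqmodP/asboolP[c c0 e] :
    repr (proj v) = insubd ones v %[mod {eq_quot collinear}].
  exact: reprK.
by exists c => //; rewrite /hvec e insubdK.
Qed.

End ProjectiveSpace.
Arguments projective_space R n : clear implicits.

Section ProjectiveMaps.
Context {R : realType}.
Local Notation C := (Cplx R).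
Local Notation CP n := (projective_space R n).

(* The map [v] |-> [M v]; meaningful where M v != 0. *)
Definition projmap {m n} (M : 'M[C]_(n.+1, m.+1)) (p : CP m) : CP n :=
  proj (M *m hvec p).

Lemma projmap_proj m n (M : 'M[C]_(n.+1, m.+1)) v :
  M *m v != 0 -> projmap M (proj v) = proj (M *m v).
Proof.
move=> Mv0; have v0 : v != 0 by apply: contraNneq Mv0 => ->; rewrite mulmx0.
have [c c0 e] := hvec_proj v0.
by rewrite /projmap e -scalemxAr proj_scale.
Qed.

Lemma projmap1 n (p : CP n) : projmap 1%:M p = p.
Proof. by rewrite /projmap mul1mx projK. Qed.

Lemma mul_hvec_neq0 m n (M : 'M[C]_(n, m.+1)) (N : 'M[C]_(m.+1, n)) p :
  N *m M = 1%:M -> M *m hvec p != 0.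
Proof.
move=> NM; apply: contraNneq (hvec_neq0 p) => Mp0.
by rewrite -[hvec p]mul1mx -NM -mulmxA Mp0 mulmx0.
Qed.

Lemma projmapM l m n (M : 'M[C]_(n.+1, m.+1)) (N : 'M[C]_(m.+1, l.+1))
    (M' : 'M[C]_(m.+1, n.+1)) (N' : 'M[C]_(l.+1, m.+1)) p :
  M' *m M = 1%:M -> N' *m N = 1%:M ->
  projmap M (projmap N p) = projmap (M *m N) p.
Proof.
move=> M'M N'N; rewrite projmap_proj mulmxA // (@mul_hvec_neq0 _ _ _ (N' *m M')) //.
by rewrite -mulmxA [M' *m _]mulmxA M'M mul1mx.
Qed.

(* Q_{n-1} in CP^n *)
Definition quadric n : set (CP n) := [set p | \sum_i hvec p i 0 ^+ 2 = 0].

Lemma quadricP n (v : 'cV[C]_n.+1) :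
  v != 0 -> quadric (proj v) <-> \sum_i v i 0 ^+ 2 = 0.
Proof.
move=> /hvec_proj[c c0 e]; rewrite /quadric /= e.
under eq_bigr do rewrite mxE exprMn.
rewrite -mulr_sumr; split=> [/eqP|->]; last by rewrite mulr0.
by rewrite mulf_eq0 expf_eq0 (negPf c0) andbF /= => /eqP.
Qed.

Definition veronese_vec d (w : 'cV[C]_2) : 'cV[C]_d.+1 :=
  \col_(i < d.+1) (sqrtC 'C(d, i)%:R * w 0 0 ^+ (d - i) * w 1 0 ^+ i).

Definition veronese {d} (p : CP 1) : CP d := proj (veronese_vec d (hvec p)).

Lemma veronese_vec_neq0 d w : w != 0 -> veronese_vec d w != 0.
Proof.
apply: contra_neq => /matrixP e; apply/matrixP => i j.
rewrite (ord1 j) !mxE; have {}e k := e k 0.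
have w0 : w 0 0 = 0.
  have /eqP := e ord0; rewrite !mxE /= bin0 sqrtC1 mul1r subn0 expr0 mulr1.
  by rewrite expf_eq0 => /andP[_ /eqP].
have w1 : w 1 0 = 0.
  have /eqP := e ord_max; rewrite !mxE /= binn sqrtC1 mul1r subnn expr0 mul1r.
  by rewrite expf_eq0 => /andP[_ /eqP].
case: i => -[|[|//]] lti.
- by rewrite -[RHS]w0; congr (w _ _); exact: val_inj.
- by rewrite -[RHS]w1; congr (w _ _); exact: val_inj.
Qed.

Lemma veronese_proj d w : w != 0 ->
  veronese (proj w) = proj (veronese_vec d w) :> CP d.
Proof.
move=> w0; have [c c0 e] := hvec_proj w0; rewrite /veronese e.
have -> : veronese_vec d (c *: w) = c ^+ d *: veronese_vec d w.
  apply/matrixP => i j; rewrite !mxE !exprMn.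
  have -> : c ^+ d = c ^+ (d - i) * c ^+ i by rewrite -exprD subnK // -ltnS.
  by rewrite [X in X * _ = _]mulrCA mulrACA.
by rewrite proj_scale ?expf_neq0 // veronese_vec_neq0.
Qed.

(* Appending a zero homogeneous coordinate. *)
Definition cp_incl n : CP n -> CP n.+1 := projmap (pid_mx n.+1).

End ProjectiveMaps.
Arguments quadric R n : clear implicits.
Arguments veronese R d p : clear implicits.

Section Spheres.
Context {R : realType}.
Local Notation C := (Cplx R).
Local Notation CP n := (projective_space R n).

(* H_{d,n}, as parametrized maps: E and c E with |c| = 1 give the same element.
   Subsets of a topological space, used as types, carry the induced topology. *)
Definition spheres d n : set {compact-open, CP 1 -> CP n} :=
  [set f | exists E : 'M[C]_(n.+1, d.+1),
    [/\ E^t* *m E = 1%:M, f = projmap E \o veronese R d &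
        range f `<=` quadric R n]].
Arguments spheres : clear implicits.

Definition complexify {m n} : 'M[R]_(m, n) -> 'M[C]_(m, n) :=
  map_mx (real_complex R).

Definition congruent {n} (f g : CP 1 -> CP n) : Prop :=
  exists A : 'M[R]_n.+1, exists U : 'M[C]_2,
    [/\ A *m A^T = 1%:M, U \is unitarymx, \det U = 1 &
        g = projmap (complexify A) \o f \o projmap U].

Lemma complexify_orth n (A : 'M[R]_n) : A *m A^T = 1%:M ->
  complexify A *m complexify A^T = 1%:M.
Proof. by move=> AA; rewrite /complexify -map_mxM AA map_mx1. Qed.

Lemma congruent_refl n (f : CP 1 -> CP n) : congruent f f.
Proof.
exists 1%:M, 1%:M; split.
- by rewrite trmx1 mulmx1.
- by apply/unitarymxP; rewrite trmx1 map_mx1 mulmx1.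
- exact: det1.
- by apply: boolp.funext => p /=; rewrite /complexify map_mx1 !projmap1.
Qed.

Lemma congruent_sym n (f g : CP 1 -> CP n) : congruent f g -> congruent g f.
Proof.
move=> [A [U [AA UU dU ->]]].
have AAc := complexify_orth AA.
have UUs : U *m U^t* = 1%:M by exact/unitarymxP.
exists A^T, (U^t*); split.
- by rewrite trmxK; exact: mulmx1C.
- by rewrite trmxC_unitary.
- by rewrite det_map_mx det_tr dU rmorph1.
- apply: boolp.funext => p /=.
  rewrite [X in projmap _ (projmap _ (f X))](projmapM _ (mulmx1C UUs) UUs).
  rewrite UUs projmap1 (projmapM _ AAc (mulmx1C AAc)).
  by rewrite (mulmx1C AAc) projmap1.
Qed.

Lemma congruent_trans n (f g h : CP 1 -> CP n) :
  congruent f g -> congruent g h -> congruent f h.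
Proof.
move=> [A [U [AA UU dU ->]]] [B [V [BB VV dV ->]]].
have AAc := complexify_orth AA; have BBc := complexify_orth BB.
have UUs : U *m U^t* = 1%:M by exact/unitarymxP.
have VVs : V *m V^t* = 1%:M by exact/unitarymxP.
exists (B *m A), (U *m V); split.
- by rewrite trmx_mul mulmxA -(mulmxA B) AA mulmx1.
- by rewrite mul_unitarymx.
- by rewrite det_mulmx dU dV mulr1.
- apply: boolp.funext => p /=; rewrite (projmapM _ (mulmx1C UUs) (mulmx1C VVs)).
  by rewrite (projmapM _ (mulmx1C BBc) (mulmx1C AAc)) /complexify map_mxM.
Qed.

Section Moduli.
Variables d n : nat.

Definition congruentb (f g : spheres d n) : bool :=
  `[< congruent (val f) (val g) >].

Lemma congruentb_equiv : equiv_class_of congruentb.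
Proof.
split=> [f|f g|g f h].
- exact/asboolP/congruent_refl.
- by apply/asboolP/asboolP; exact: congruent_sym.
- by move=> /asboolP fg /asboolP gh; apply/asboolP; exact: congruent_trans gh.
Qed.

Canonical congruentb_equivRel := EquivRelPack congruentb_equiv.

(* H_{d,n} / O(n+1; R), with the quotient topology. *)
Definition moduli : Type := quotient_topology {eq_quot congruentb}.

End Moduli.

Lemma pid_mxK (F : comNzRingType) n :
  pid_mx n.+1 *m (pid_mx n.+1 : 'M[F]_(n.+2, n.+1)) = 1%:M :> 'M[F]_n.+1.
Proof. by rewrite mul_pid_mx minnn (minn_idPr (leqnSn _)) pid_mx_1. Qed.

Lemma cp_incl_spheres d n (f : CP 1 -> CP n) :
  spheres d n f -> spheres d n.+1 (@cp_incl R n \o f).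
Proof.
move=> [E [EE -> sub]]; exists (pid_mx n.+1 *m E); split.
- rewrite trmx_mul map_mxM tr_pid_mx map_pid_mx mulmxA.
  by rewrite -(mulmxA _ (pid_mx _) (pid_mx _)) pid_mxK mulmx1.
- by apply: boolp.funext => p; rewrite /= /cp_incl (projmapM _ (pid_mxK _ _) EE).
- move=> _ [p _ <-] /=; set q := projmap E _.
  have qQ : quadric R n q by apply: sub; exists p.
  apply/quadricP; first exact: mul_hvec_neq0 (pid_mxK _ _).
  have tr m (v : 'cV[C]_m) : \sum_i v i 0 ^+ 2 = (v^T *m v) 0 0.
    by rewrite mxE; apply: eq_bigr => i _; rewrite mxE.
  rewrite tr trmx_mul tr_pid_mx -mulmxA (mulmxA (pid_mx _)) pid_mxK mul1mx -tr.
  exact: qQ.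
Qed.

Definition sphere_incl d n (f : spheres d n) : spheres d n.+1 :=
  exist (fun g => g \in spheres d n.+1) _
    (mem_set (cp_incl_spheres (set_mem (valP f)))).

(* The map induced by sphere_incl on classes; see moduli_inclE. *)
Definition moduli_incl d n (x : moduli d n) : moduli d n.+1 :=
  \pi_(moduli d n.+1) (sphere_incl (repr x)).

Lemma congruent_incl n (f g : CP 1 -> CP n) :
  congruent f g -> congruent (@cp_incl R n \o f) (@cp_incl R n \o g).
Proof.
move=> [A [U [AA UU dU ->]]].
pose P : 'M[R]_(n.+2, n.+1) := pid_mx n.+1.
pose Q : 'M[R]_(n.+1, n.+2) := pid_mx n.+1.
have QP : Q *m P = 1%:M by exact: pid_mxK.
have PT : P^T = Q by exact: tr_pid_mx.
have QT : Q^T = P by exact: tr_pid_mx.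
pose A' := P *m A *m Q + (1%:M - P *m Q).
have A'P : A' *m P = P *m A.
  by rewrite mulmxDl mulmxBl mul1mx -!mulmxA QP !mulmx1 subrr addr0.
have A'T : A'^T = P *m A^T *m Q + (1%:M - P *m Q).
  by rewrite linearD linearB /= !trmx_mul trmx1 PT QT mulmxA.
have AA' : A' *m A'^T = 1%:M.
  rewrite A'T mulmxDr mulmxBr mulmx1 !mulmxA A'P -(mulmxA P A) AA mulmx1.
  by rewrite /A' addrAC subrr add0r addrC subrK.
exists A', U; split=> //; apply: boolp.funext => p /=; rewrite /cp_incl.
have AAc := complexify_orth AA; have AA'c := complexify_orth AA'.
rewrite (projmapM _ (pid_mxK _ _) (mulmx1C AAc)).
rewrite (projmapM _ (mulmx1C AA'c) (pid_mxK _ _)).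
have -> : pid_mx n.+1 = complexify P :> 'M[C]_(n.+2, n.+1).
  by rewrite /complexify map_pid_mx.
by rewrite /complexify -!map_mxM A'P.
Qed.

Lemma moduli_inclE d n (f : spheres d n) :
  moduli_incl (\pi_(moduli d n) f) = \pi_(moduli d n.+1) (sphere_incl f).
Proof.
rewrite /moduli_incl; apply/eqmodP/asboolP/congruent_incl.
have /eqmodP/asboolP :
    repr (\pi_(moduli d n) f) = f %[mod {eq_quot @congruentb d n}].
  exact: reprK.
by [].
Qed.

End Spheres.
Arguments spheres R d n : clear implicits.
Arguments moduli R d n : clear implicits.
Arguments moduli_incl R d n x : clear implicits.

(* Main.v *)
Require Import Defs.
From HB Require Import structures.
From mathcomp Require Import all_boot all_order all_algebra.
From mathcomp Require Import all_classical all_reals all_analysis.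
From mathcomp Require Import complex ring lra.

(** A degree two sphere in the quadric is w |-> [E Z(w)] with E an isometry
    and Z(w) = (u^2, sqrt 2 u v, v^2). Lying in the quadric means that the
    symmetric matrix S = E^T E satisfies Z(w)^T S Z(w) = 0 for all w;
    comparing the coefficients of this quartic form leaves only S = s J, with
    J antidiagonal with entries 1, -1, 1 ([conic_form], [spheresP]).

    The number |s| is a complete invariant. The Gram matrices of E for the
    hermitian and for the bilinear product determine E up to a real orthogonal
    map ([gram_complex], a consequence of the real Gram theorem [gram_orth],
    which is proved with reflections), and the first of them is the identity;
    multiplying E by a phase does not move the sphere and changes s by the
    square of that phase, so |s| suffices ([congruent_gram]). Conversely
    Z(p)^T J Z(q) = (p /\ q)^2 is SL2-invariant ([dot_antidiag]), so that
    |s|^2 is recovered as the overlap |v^T w|^2 / (|v|^2 |w|^2) of the values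
    v, w of the sphere at any two antipodal points ([overlap_congruent]). This
    overlap is insensitive to homogeneous coordinates, to real orthogonal maps
    and to SU(2), and depends on two values of the sphere only, hence
    continuously for the compact-open topology ([invariant_continuous]).

    Cauchy-Schwarz gives |s| <= 1. If |s| < 1, the six columns of E and of its
    conjugate are linearly independent, so the ambient space has dimension at
    least six ([gram_param_norm1]). In CP^2, CP^3 and CP^4 therefore |s| = 1
    and the moduli space has at most one point; an explicit conic in CP^2 and
    its images under the inclusions show that it has one. In CP^5 an explicit
    continuous family of spheres realizes every |s|^2 in [0, 1]
    ([conic_path_spheres]); its class is a continuous inverse of the
    invariant, by currying a jointly continuous map. *)

Set Implicit Arguments.
Unset Strict Implicit.
Unset Printing Implicit Defensive.

Import Order.TTheory GRing.Theory Num.Theory.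
Import numFieldNormedType.Exports.

Local Open Scope classical_set_scope.
Local Open Scope quotient_scope.
Local Open Scope sesquilinear_scope.
Local Open Scope ring_scope.

Local Notation proj := Defs.proj.

(** * Gram matrices and real orthogonal maps *)

Definition dotmx {F : fieldType} {n} (x y : 'cV[F]_n) : F := (x^T *m y) 0 0.

Lemma dotmxE (F : fieldType) n (x y : 'cV[F]_n) :
  dotmx x y = \sum_i x i 0 * y i 0.
Proof. by rewrite /dotmx mxE; apply: eq_bigr => i _; rewrite mxE. Qed.

Lemma dotmxC (F : fieldType) n (x y : 'cV[F]_n) : dotmx x y = dotmx y x.
Proof. by rewrite !dotmxE; apply: eq_bigr => i _; rewrite mulrC. Qed.

Lemma dotmxBl (F : fieldType) n (x y z : 'cV[F]_n) :
  dotmx (x - y) z = dotmx x z - dotmx y z.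
Proof. by rewrite /dotmx linearB /= mulmxBl !mxE. Qed.

Lemma dotmx_eq0 (R : realFieldType) n (x : 'cV[R]_n) :
  (dotmx x x == 0) = (x == 0).
Proof.
rewrite dotmxE; apply/idP/eqP => [|->]; last first.
  by rewrite big1 // => i _; rewrite !mxE mulr0.
rewrite psumr_eq0 => [/allP e|i _]; last by rewrite -expr2 sqr_ge0.
apply/matrixP => i j; rewrite (ord1 j) mxE; apply/eqP.
by have := e i (mem_index_enum _); rewrite mulf_eq0 orbb.
Qed.

Lemma dotmx_orth (F : fieldType) n (A : 'M[F]_n) (x y : 'cV[F]_n) :
  A^T *m A = 1%:M -> dotmx (A *m x) (A *m y) = dotmx x y.
Proof.
by move=> AA; rewrite /dotmx trmx_mul -mulmxA (mulmxA A^T) AA mul1mx.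
Qed.

Lemma dotmx_col (F : fieldType) n k (M N : 'M[F]_(n, k)) i j :
  dotmx (col i M) (col j N) = (M^T *m N) i j.
Proof. by rewrite dotmxE mxE; apply: eq_bigr => l _; rewrite !mxE. Qed.

(** The reflection in the hyperplane orthogonal to x - y exchanges x and y
    when they have the same length; if x = y the identity does. *)
Lemma reflection_exists (R : realFieldType) n (x y : 'cV[R]_n) :
  dotmx x x = dotmx y y ->
  exists H : 'M[R]_n, [/\ H^T *m H = 1%:M, H *m x = y &
    forall z, dotmx x z = dotmx y z -> H *m z = z].
Proof.
move=> xy; have [->|xNy] := eqVneq x y.
  by exists 1%:M; rewrite trmx1 mulmx1; split=> // *; rewrite mul1mx.
pose u := x - y; pose q := dotmx u u.
have q0 : q != 0 by rewrite dotmx_eq0 subr_eq0.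
pose H := 1%:M - (2 / q) *: (u *m u^T).
have Hz z : H *m z = z - (2 / q * dotmx u z) *: u.
  rewrite mulmxBl mul1mx -scalemxAl -mulmxA [u^T *m z]mx11_scalar mul_mx_scalar.
  by rewrite scalerA.
have HT : H^T = H by rewrite linearB linearZ /= trmx1 trmx_mul trmxK.
exists H; split.
- have Hu : H *m u = - u.
    by rewrite Hz -/q divfK // scaler_nat mulr2n opprD addNKr.
  by rewrite HT {2}/H mulmxBr mulmx1 -scalemxAr mulmxA Hu mulNmx scalerN opprK
    subrK.
- rewrite Hz (_ : 2 / q * _ = 1) ?scale1r ?subKr //.
  have qE : q = 2 * dotmx u x.
    rewrite /q /u dotmxBl !(dotmxC _ (x - y)) !dotmxBl -xy (dotmxC y x).
    by ring.
  by rewrite mulrAC -qE divff.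
- by move=> z xz; rewrite Hz dotmxBl xz subrr mulr0 scale0r subr0.
Qed.

(** Families of vectors with the same Gram matrix differ by an orthogonal map.
    The map is built one column at a time: once the first j columns agree, a
    reflection moves the next one into place, and it fixes the previous ones
    because their products with both vectors are prescribed by the Gram
    matrix. *)
Lemma gram_orth (R : realFieldType) n k (M N : 'M[R]_(n, k)) :
  M^T *m M = N^T *m N -> exists2 A : 'M[R]_n, A *m A^T = 1%:M & A *m M = N.
Proof.
move=> MN; suff IH j : (j <= k)%N -> exists2 A : 'M[R]_n, A^T *m A = 1%:M &
    forall i : 'I_k, (i < j)%N -> A *m col i M = col i N.
  have [A AA AMN] := IH k (leqnn k); exists A; first exact: mulmx1C.
  apply/matrixP => i j; have /matrixP/(_ i 0) := AMN j (ltn_ord j).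
  by rewrite !mxE => <-; apply: eq_bigr => l _; rewrite !mxE.
elim: j => [_|j IH jk].
  by exists 1%:M; rewrite // trmx1 mulmx1.
have [A AA AMN] := IH (ltnW jk); pose l := Ordinal jk.
have gram i i' : dotmx (col i M) (col i' M) = dotmx (col i N) (col i' N).
  by rewrite !dotmx_col MN.
have [|H [HH Hl Hfix]] := @reflection_exists _ _ (A *m col l M) (col l N).
  by rewrite dotmx_orth.
exists (H *m A); first by rewrite trmx_mul -mulmxA (mulmxA H^T) HH mul1mx.
move=> i; rewrite ltnS leq_eqVlt => /predU1P[il|ij].
  by rewrite -mulmxA (_ : i = l) //; apply: val_inj.
by rewrite -mulmxA AMN // Hfix // -gram -AMN // dotmx_orth.
Qed.

Section Complex.
Variable R : realType.
Local Notation C := (Cplx R).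

Definition Remx {m n} (E : 'M[C]_(m, n)) : 'M[R]_(m, n) :=
  map_mx (@complex.Re R) E.
Definition Immx {m n} (E : 'M[C]_(m, n)) : 'M[R]_(m, n) :=
  map_mx (@complex.Im R) E.

Lemma Re_sum n (F : 'I_n -> C) :
  complex.Re (\sum_i F i) = \sum_i complex.Re (F i).
Proof. exact: (raddf_sum (@complex.Re R)). Qed.

Lemma Im_sum n (F : 'I_n -> C) :
  complex.Im (\sum_i F i) = \sum_i complex.Im (F i).
Proof. exact: (raddf_sum (@complex.Im R)). Qed.

Lemma conjCE (z : C) : z^* = (complex.Re z -i* complex.Im z)%C.
Proof. by case: z. Qed.

Lemma ReM (x y : C) : complex.Re (x * y) =
  complex.Re x * complex.Re y - complex.Im x * complex.Im y.
Proof. by case: x; case: y. Qed.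

Lemma ImM (x y : C) : complex.Im (x * y) =
  complex.Re x * complex.Im y + complex.Im x * complex.Re y.
Proof. by case: x => a b; case: y => c d /=; rewrite [b * c]mulrC. Qed.

Lemma ReD (x y : C) : complex.Re (x + y) = complex.Re x + complex.Re y.
Proof. by case: x; case: y. Qed.

Lemma ReB (x y : C) : complex.Re (x - y) = complex.Re x - complex.Re y.
Proof. by case: x; case: y. Qed.

Lemma ImD (x y : C) : complex.Im (x + y) = complex.Im x + complex.Im y.
Proof. by case: x; case: y. Qed.

(** The hermitian and bilinear Gram matrices of E = X + i Y determine the real
    Gram matrix of the columns of X and Y together: X^T X and Y^T Y are half
    the real parts of their sum and of their difference, and X^T Y is half the
    imaginary part of their sum. *)
Lemma gram_complex n k (E F : 'M[C]_(n, k)) :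
  E^t* *m E = F^t* *m F -> E^T *m E = F^T *m F ->
  exists2 A : 'M[R]_n, A *m A^T = 1%:M & complexify A *m E = F.
Proof.
move=> hE sE.
pose M (G : 'M[C]_(n, k)) := row_mx (Remx G) (Immx G).
have ReG (G : 'M[C]_(n, k)) i j :
    ((Remx G)^T *m Remx G) i j * 2 =
    complex.Re ((G^t* *m G) i j + (G^T *m G) i j).
  rewrite !mxE ReD !Re_sum -big_split mulr_suml; apply: eq_bigr => l _ /=.
  by rewrite !mxE !ReM conjCE /=; ring.
have ImG (G : 'M[C]_(n, k)) i j :
    ((Immx G)^T *m Immx G) i j * 2 =
    complex.Re ((G^t* *m G) i j - (G^T *m G) i j).
  rewrite !mxE ReB !Re_sum -sumrB mulr_suml.
  by apply: eq_bigr => l _ /=; rewrite !mxE !ReM conjCE /=; ring.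
have ReImG (G : 'M[C]_(n, k)) i j :
    ((Remx G)^T *m Immx G) i j * 2 =
    complex.Im ((G^t* *m G) i j + (G^T *m G) i j).
  rewrite !mxE ImD !Im_sum -big_split mulr_suml; apply: eq_bigr => l _ /=.
  by rewrite !mxE !ImM conjCE /=; ring.
have cancel2 (a b : R) : a * 2 = b * 2 -> a = b.
  by move=> /mulIf; apply; rewrite pnatr_eq0.
have [|A AA] := @gram_orth _ _ _ (M E) (M F).
  rewrite !tr_row_mx !mul_col_row.
  have e : (Remx E)^T *m Immx E = (Remx F)^T *m Immx F.
    by apply/matrixP => i j; apply: cancel2; rewrite !ReImG hE sE.
  congr block_mx => //.
  - by apply/matrixP => i j; apply: cancel2; rewrite !ReG hE sE.
  - apply: trmx_inj; rewrite !trmx_mul !trmxK; exact: e.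
  - by apply/matrixP => i j; apply: cancel2; rewrite !ImG hE sE.
rewrite mul_mx_row => /eq_row_mx[AX AY].
exists A => //; apply/matrixP => i j.
have /matrixP/(_ i j) := AX; have /matrixP/(_ i j) := AY; rewrite !mxE => eY eX.
apply/eqP; rewrite eq_complex; apply/andP; split; apply/eqP.
- rewrite Re_sum -eX; apply: eq_bigr => l _; rewrite !mxE ReM /=; ring.
- rewrite Im_sum -eY; apply: eq_bigr => l _; rewrite !mxE ImM /=; ring.
Qed.

End Complex.

(** * Degree two spheres in the quadric *)

Section Conic.
Variable R : realType.
Local Notation C := (Cplx R).
Local Notation CP n := (projective_space R n).
Local Notation Z := (@veronese_vec R 2).

Definition antidiag : 'M[C]_3 :=
  \matrix_(i, j) (if (i + j == 2)%N then (-1) ^+ i else 0).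

Definition wedge (p q : 'cV[C]_2) : C := p 0 0 * q 1 0 - p 1 0 * q 0 0.

Definition sqnorm {n} (v : 'cV[C]_n) : C := \sum_i `|v i 0| ^+ 2.

Lemma big3 (V : nmodType) (F : 'I_3 -> V) :
  \sum_i F i = F 0 + F 1 + F 2%:R.
Proof.
rewrite !big_ord_recl big_ord0 addr0 addrA.
by congr (F _ + F _ + F _); apply: val_inj.
Qed.

Lemma big2 (V : nmodType) (F : 'I_2 -> V) : \sum_i F i = F 0 + F 1.
Proof.
by rewrite !big_ord_recl big_ord0 addr0; congr (F _ + F _); apply: val_inj.
Qed.

Lemma sqr_sqrtC2 : sqrtC 2 ^+ 2 = 2 :> C.
Proof. exact: sqrtCK. Qed.

Lemma veroneseE w : [/\ Z w 0 0 = w 0 0 ^+ 2,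
  Z w 1 0 = sqrtC 2 * w 0 0 * w 1 0 & Z w 2%:R 0 = w 1 0 ^+ 2].
Proof.
by rewrite !mxE /= !binn bin0 bin1 sqrtC1 !mul1r !expr1 !expr0 !mulr1.
Qed.

(** The form on the symmetric square of C^2 induced by the area form: this is
    why the antidiagonal matrix is invariant under SU(2). *)
Lemma dot_antidiag p q : dotmx (Z p) (antidiag *m Z q) = wedge p q ^+ 2.
Proof.
rewrite dotmxE big3 ![(_ *m _) _ _]mxE !big3.
have [-> -> ->] := veroneseE p; have [-> -> ->] := veroneseE q.
rewrite !mxE /= /wedge.
have := sqr_sqrtC2; move: (sqrtC 2) => r r2.
ring: r2.
Qed.

Lemma sqnorm_veronese p : sqnorm (Z p) = sqnorm p ^+ 2.
Proof.
rewrite /sqnorm big3 big2.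
have [-> -> ->] := veroneseE p.
rewrite !normrM.
have -> : `|sqrtC 2 : C| = sqrtC 2 by rewrite ger0_norm // sqrtC_ge0.
have := sqr_sqrtC2; move: (sqrtC 2) => r r2.
ring: r2.
Qed.

(** Up to nonzero factors, the coefficients of the quartic form Z(w)^T S Z(w)
    are S00, S01, S11 + S02, S12 and S22; their vanishing is extracted from
    the values at the five points (1, 0), (0, 1), (1, 1), (1, -1) and (1, i). *)
Lemma conic_form (S : 'M[C]_3) : S^T = S ->
  (forall w : 'cV[C]_2, w != 0 -> dotmx (Z w) (S *m Z w) = 0) ->
  exists s, S = s *: antidiag.
Proof.
move=> /matrixP sym SZ; exists (S 0 2%:R).
pose v (a b : C) : 'cV[C]_2 := \col_i (if i == 0 then a else b).
have quartic a b : (a != 0) || (b != 0) ->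
    S 0 0 * a ^+ 4 + 2 * sqrtC 2 * S 0 1 * a ^+ 3 * b
    + 2 * (S 1 1 + S 0 2%:R) * a ^+ 2 * b ^+ 2
    + 2 * sqrtC 2 * S 1 2%:R * a * b ^+ 3 + S 2%:R 2%:R * b ^+ 4 = 0.
  move=> ab; have v0 : v a b != 0.
    apply: contraTneq ab => /matrixP e; rewrite negb_or !negbK.
    have := e 0 0; have := e 1 0; rewrite !mxE /= => -> ->.
    by rewrite eqxx.
  rewrite -[RHS](SZ _ v0) dotmxE big3 ![(_ *m _) _ _]mxE !big3.
  have [-> -> ->] := veroneseE (v a b); rewrite !mxE /=.
  have := sym 1 0; have := sym 2%:R 0; have := sym 2%:R 1.
  rewrite !mxE => <- <- <-.
  have := sqr_sqrtC2; move: (sqrtC 2) => r r2.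
  ring: r2.
have s0 : S 0 0 = 0.
    by have := quartic 1 0; rewrite oner_eq0 => /(_ isT) <-; ring.
  have s2 : S 2%:R 2%:R = 0.
    by have := quartic 0 1; rewrite oner_eq0 orbT => /(_ isT) <-; ring.
  have {}quartic a b : (a != 0) || (b != 0) ->
      2 * sqrtC 2 * S 0 1 * a ^+ 3 * b
      + 2 * (S 1 1 + S 0 2%:R) * a ^+ 2 * b ^+ 2
      + 2 * sqrtC 2 * S 1 2%:R * a * b ^+ 3 = 0.
    by move=> /quartic <-; rewrite s0 s2; ring.
  have q1 := quartic 1 1; have q2 := quartic 1 (-1); have q3 := quartic 1 'i.
  move: q1 q2 q3; rewrite oner_eq0 => /(_ isT) q1 /(_ isT) q2 /(_ isT) q3.
  have ii := @sqrCi C.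
  have r0 : 2 * sqrtC 2 != 0 :> C by rewrite mulf_neq0 ?sqrtC_eq0 ?pnatr_eq0.
  have two0 : 2 != 0 :> C by rewrite pnatr_eq0.
  have s11 : S 1 1 = - S 0 2%:R.
    apply/eqP; rewrite -addr_eq0; apply/eqP; apply: (mulfI two0).
    apply: (mulfI two0); rewrite !mulr0 -[RHS](addr0 0) -{1}q1 -q2; ring.
  have s01 : S 0 1 = - S 1 2%:R.
    apply/eqP; rewrite -addr_eq0; apply/eqP; apply: (mulfI two0).
    apply: (mulfI r0); rewrite !mulr0 -[RHS](subr0 0) -{1}q1 -q2; ring.
  have s12 : S 1 2%:R = 0.
    have i0 : 'i != 0 :> C := neq0Ci C.
    (* at (1, i) the odd terms add up to 2 sqrt 2 i (S01 - S12) *)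
    apply: (mulfI two0); apply: (mulfI r0); apply: (mulfI i0).
    rewrite !mulr0 -[RHS](oppr0) -q3 s01 s11; move: ('i) ii => i ii; ring: ii.
  apply/matrixP => i j.
  have e3 (k : 'I_3) : [\/ k = 0, k = 1 | k = 2%:R].
    by case: k => [[|[|[|//]]]] ?;
      [apply: Or31|apply: Or32|apply: Or33]; apply: val_inj.
  have symE a b : S a b = S b a by rewrite -[LHS]sym mxE.
  rewrite !mxE; have [->|->|->] := e3 i; have [->|->|->] := e3 j;
    rewrite /= ?(symE 1 0) ?(symE 2%:R 0) ?(symE 2%:R 1) ?s01 ?s12 ?s0 ?s11 ?s2;
    ring.
Qed.

Lemma dotmx_mul m n (A : 'M[C]_(m, n)) x y :
  dotmx (A *m x) (A *m y) = dotmx x (A^T *m A *m y).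
Proof. by rewrite /dotmx trmx_mul !mulmxA. Qed.

Lemma sqnormE n (v : 'cV[C]_n) : sqnorm v = (v^t* *m v) 0 0.
Proof. by rewrite mxE; apply: eq_bigr => i _; rewrite !mxE normCKC. Qed.

Lemma sqnorm_iso m n (A : 'M[C]_(m, n)) v :
  A^t* *m A = 1%:M -> sqnorm (A *m v) = sqnorm v.
Proof.
by move=> AA; rewrite !sqnormE trmx_mul map_mxM -mulmxA (mulmxA _ A) AA mul1mx.
Qed.

Lemma sqnorm_eq0 n (v : 'cV[C]_n) : (sqnorm v == 0) = (v == 0).
Proof.
apply/idP/eqP => [|->]; last first.
  by rewrite /sqnorm big1 // => i _; rewrite mxE normr0 expr0n.
rewrite psumr_eq0 => [/allP e|i _]; last by rewrite exprn_ge0.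
apply/matrixP => i j; rewrite (ord1 j) mxE; apply/eqP.
by have := e i (mem_index_enum _); rewrite /= expf_eq0 normr_eq0.
Qed.

(** The condition of lying in the quadric becomes linear algebra on E. *)
Lemma spheresP n (f : CP 1 -> CP n) : spheres R 2 n f <->
  exists E : 'M[C]_(n.+1, 3), exists s : C,
    [/\ E^t* *m E = 1%:M, E^T *m E = s *: antidiag &
        f = projmap E \o veronese R 2].
Proof.
have quad (E : 'M[C]_(n.+1, 3)) (w : 'cV[C]_2) : E^t* *m E = 1%:M -> w != 0 ->
    quadric R n (projmap E (veronese R 2 (proj w))) <->
    dotmx (Z w) (E^T *m E *m Z w) = 0.
  move=> EE w0; have Zw0 := veronese_vec_neq0 2 w0.
  have EZ0 : E *m Z w != 0.
    by rewrite -sqnorm_eq0 sqnorm_iso // sqnorm_eq0.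
  rewrite veronese_proj // projmap_proj // quadricP // -dotmx_mul dotmxE.
  by under eq_bigr do rewrite expr2.
split=> [[E [EE fE sub]]|[E [s [EE sE fE]]]]; exists E.
- have [||s sE] := @conic_form (E^T *m E); first by rewrite trmx_mul trmxK.
    move=> w w0; apply/quad => //; apply: sub.
    by exists (proj w) => //; rewrite fE.
  by exists s.
- split=> // _ [p _ <-]; rewrite fE -(Defs.projK p) /=; apply/quad => //.
    exact: hvec_neq0.
  rewrite sE -scalemxAl.
  rewrite /dotmx -scalemxAr mxE -/(dotmx _ _) dot_antidiag /wedge.
  by rewrite mulrC [X in X - _]mulrC subrr expr0n mul0r.
Qed.

Lemma antidiagE : [/\ antidiag^T = antidiag, antidiag *m antidiag = 1%:M &
  map_mx Num.Def.conjC antidiag = antidiag].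
Proof.
split; apply/matrixP => i j; rewrite !mxE ?big3 ?mxE.
- by case: i => [[|[|[|//]]] ?]; case: j => [[|[|[|//]]] ?]; rewrite /=; ring.
- by case: i => [[|[|[|//]]] ?]; case: j => [[|[|[|//]]] ?];
  rewrite ?mxE /=; ring.
- by case: ifP; rewrite ?rmorphXn ?rmorphN ?rmorph1 ?rmorph0.
Qed.

Lemma conj_gram m n (E : 'M[C]_(m, n)) :
  E^T *m map_mx Num.Def.conjC E = map_mx Num.Def.conjC (E^t* *m E).
Proof.
rewrite map_mxM; congr (_ *m _).
by apply/matrixP => i j; rewrite !mxE /= conjCK.
Qed.

(** With at most five rows, E and its conjugate have six columns between them
    and so satisfy a linear relation E a + conj(E) b = 0. Multiplying it by
    the adjoint and by the transpose of E gives a = |s|^2 a and b = - s J a,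
    whence |s| = 1. The relation is written with row vectors, to use kernels
    on the left. *)
Lemma gram_param_norm1 n (E : 'M[C]_(n.+1, 3)) s : (n < 5)%N ->
  E^t* *m E = 1%:M -> E^T *m E = s *: antidiag -> `|s| = 1.
Proof.
move=> n5 EE sE; have [JT JJ Jc] := antidiagE.
apply/eqP; rewrite -(@eqrXn2 _ 2) // expr1n; apply/eqP.
pose B := col_mx E^T (E^t*).
have kB : kermx B != 0.
  rewrite -mxrank_eq0 mxrank_ker subn_eq0 -ltnNge.
  exact: leq_ltn_trans (rank_leq_col _) _.
have [x xB x0] : exists2 x : 'rV_(3 + 3), x *m B = 0 & x != 0.
  have /rowV0Pn[x xk x0] := kB; exists x => //; exact/sub_kermxP.
pose a := lsubmx x; pose b := rsubmx x.
have aEb : a *m E^T + b *m E^t* = 0 by rewrite -mul_row_col hsubmxK.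
have e1 : s *: a *m antidiag + b = 0.
  have /(congr1 (mulmx^~ E)) := aEb.
  by rewrite mulmxDl -!mulmxA EE sE mulmx1 mul0mx -scalemxAr scalemxAl.
have e2 : a + s^* *: b *m antidiag = 0.
  have /(congr1 (mulmx^~ (map_mx Num.Def.conjC E))) := aEb.
  rewrite mulmxDl -!mulmxA conj_gram EE map_mx1 mulmx1 mul0mx.
  have -> : E^t* *m map_mx Num.Def.conjC E = map_mx Num.Def.conjC (E^T *m E).
    by rewrite map_mxM.
  by rewrite sE map_mxZ Jc -scalemxAr scalemxAl.
have bE : b = - (s *: a *m antidiag) by apply/eqP; rewrite -addr_eq0 addrC e1.
move/eqP: e2; rewrite bE scalerN mulNmx -!scalemxAl -mulmxA JJ mulmx1 scalerA.
rewrite subr_eq0 -{1}[a]scale1r -subr_eq0 -scalerBl scaler_eq0.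
move=> /orP[|/eqP a0].
  by rewrite subr_eq0 => /eqP ->; rewrite normCKC.
case/negP: x0; apply/eqP; rewrite -[x]hsubmxK -/a -/b bE a0.
by rewrite scaler0 mul0mx oppr0 row_mx0.
Qed.

End Conic.

(** * The invariant of a sphere *)

Section Invariant.
Variable R : realType.
Local Notation C := (Cplx R).
Local Notation CP n := (projective_space R n).
Local Notation Z := (@veronese_vec R 2).
Local Notation J := (@antidiag R).

Lemma dotmx_sqnorm_le n (v w : 'cV[C]_n) : sqnorm v = 1 -> sqnorm w = 1 ->
  `|dotmx v w| <= 1.
Proof.
move=> v1 w1; rewrite dotmxE; apply: le_trans (ler_norm_sum _ _ _) _.
have two0 : 0 < 2 :> C by rewrite ltr0n.
rewrite -(ler_pM2l two0) mulr1.
apply: (@le_trans _ _ (sqnorm v + sqnorm w)); last by rewrite v1 w1.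
rewrite mulr_sumr -big_split; apply: ler_sum => i _ /=.
rewrite normrM -subr_ge0 (_ : _ - _ = (`|v i 0| - `|w i 0|) ^+ 2); last by ring.
by rewrite real_exprn_even_ge0 // realB // normr_real.
Qed.

(** s is the bilinear product of the first and last columns of E, which are
    unit vectors. *)
Lemma gram_param_le1 n (E : 'M[C]_(n, 3)) s :
  E^t* *m E = 1%:M -> E^T *m E = s *: J -> `|s| <= 1.
Proof.
move=> EE sE.
have nE j : sqnorm (col j E) = 1.
  have /matrixP/(_ j j) := EE; rewrite !mxE eqxx mulr1n => <-.
  by apply: eq_bigr => i _; rewrite !mxE normCKC.
have -> : s = dotmx (col 0 E) (col 2%:R E) by rewrite dotmx_col sE !mxE mulr1.
exact: dotmx_sqnorm_le.
Qed.

Lemma complexify_tconj m n (A : 'M[R]_(m, n)) :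
  (complexify A)^t* = complexify A^T.
Proof.
apply/matrixP => i j; rewrite !mxE; apply/eqP.
by rewrite eq_complex /= oppr0 !eqxx.
Qed.

Lemma complexify_iso n (A : 'M[R]_n) : A *m A^T = 1%:M ->
  (complexify A)^t* *m complexify A = 1%:M.
Proof.
move=> AA.
by rewrite complexify_tconj /complexify -map_mxM (mulmx1C AA) map_mx1.
Qed.

Lemma complexify_orthT n (A : 'M[R]_n) : A *m A^T = 1%:M ->
  (complexify A)^T *m complexify A = 1%:M.
Proof.
by move=> AA; rewrite /complexify map_trmx -map_mxM (mulmx1C AA) map_mx1.
Qed.

Lemma norm1_sqr_rotate (s t : C) : `|s| = `|t| ->
  exists2 c : C, `|c| = 1 & c ^+ 2 * t = s.
Proof.
have [->|t0] := eqVneq t 0.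
  by rewrite normr0 => /normr0_eq0 ->; exists 1; rewrite ?normr1 ?mulr0.
move=> st; exists (sqrtC (s / t)); last by rewrite sqrtCK divfK.
apply/eqP; rewrite -(@eqrXn2 _ 2) // -normrX sqrtCK normrM normfV st expr1n.
by rewrite divff // normr_eq0.
Qed.

Lemma projmap_scale m n (c : C) (E : 'M[C]_(n.+1, m.+1)) p : c != 0 ->
  E *m hvec p != 0 -> projmap (c *: E) p = projmap E p.
Proof. by move=> c0 E0; rewrite /projmap -scalemxAl proj_scale. Qed.

Lemma iso_neq0 m n (E : 'M[C]_(n, m)) (v : 'cV[C]_m) :
  E^t* *m E = 1%:M -> v != 0 ->
  E *m v != 0.
Proof. by move=> EE v0; rewrite -sqnorm_eq0 sqnorm_iso // sqnorm_eq0. Qed.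

Lemma tconjZ m n (c : C) (E : 'M[C]_(m, n)) : (c *: E)^t* = c^* *: E^t*.
Proof. by apply/matrixP => i j; rewrite !mxE rmorphM. Qed.

(** After a change of phase the two matrices have the same Gram matrices, so a
    real orthogonal map alone carries one sphere to the other. *)
Lemma congruent_gram n (E F : 'M[C]_(n.+1, 3)) s t :
  E^t* *m E = 1%:M -> E^T *m E = s *: J ->
  F^t* *m F = 1%:M -> F^T *m F = t *: J -> `|s| = `|t| ->
  congruent (projmap E \o veronese R 2) (projmap F \o veronese R 2).
Proof.
move=> EE sE FF tF /norm1_sqr_rotate[c c1 cts].
have c0 : c != 0 by rewrite -normr_eq0 c1 oner_eq0.
have [||A AA AE] := @gram_complex R _ _ E (c *: F).
- rewrite EE tconjZ -scalemxAl -scalemxAr scalerA FF.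
  by rewrite -normCKC c1 expr1n scale1r.
- rewrite sE [(c *: F)^T]linearZ /= -scalemxAl -scalemxAr scalerA tF scalerA.
  by rewrite -expr2 cts.
exists A, 1%:M; split=> //.
- by apply/unitarymxP; rewrite trmx1 map_mx1 mulmx1.
- exact: det1.
apply: boolp.funext => p /=; rewrite projmap1.
rewrite (projmapM _ (complexify_iso AA) EE) AE projmap_scale //.
exact/iso_neq0/hvec_neq0.
Qed.

(** Unchanged by nonzero scalings of v and w, hence defines a function of two
    points of projective space. *)
Definition overlap {n} (v w : 'cV[C]_n) : C :=
  `|dotmx v w| ^+ 2 / (sqnorm v * sqnorm w).

Lemma sqnormZ n (c : C) (v : 'cV[C]_n) : sqnorm (c *: v) = `|c| ^+ 2 * sqnorm v.
Proof.
by rewrite /sqnorm mulr_sumr; apply: eq_bigr => i _; rewrite mxE normrM exprMn.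
Qed.

Lemma overlapZ n (b c : C) (v w : 'cV[C]_n) : b != 0 -> c != 0 ->
  overlap (b *: v) (c *: w) = overlap v w.
Proof.
move=> b0 c0; rewrite /overlap !sqnormZ.
rewrite /dotmx [(b *: v)^T]linearZ /= -scalemxAl -scalemxAr scalerA.
rewrite mxE -/(dotmx v w).
rewrite !normrM !exprMn [X in _ / X]mulrACA -mulf_div divff ?mul1r //.
by rewrite mulf_neq0 // expf_neq0 ?normr_eq0.
Qed.

Lemma overlap_hvec n (v w : 'cV[C]_n.+1) : v != 0 -> w != 0 ->
  overlap (hvec (proj v)) (hvec (proj w)) = overlap v w.
Proof.
move=> /hvec_proj[b b0 ->] /hvec_proj[c c0 ->]; exact: overlapZ.
Qed.

Lemma overlap_orth n (A : 'M[R]_n) (v w : 'cV[C]_n) : A *m A^T = 1%:M ->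
  overlap (complexify A *m v) (complexify A *m w) = overlap v w.
Proof.
move=> AA; rewrite /overlap !(sqnorm_iso _ (complexify_iso AA)).
by rewrite dotmx_orth // complexify_orthT.
Qed.

Lemma overlap_sphere n (E : 'M[C]_(n.+1, 3)) s (p q : 'cV[C]_2) :
  E^t* *m E = 1%:M -> E^T *m E = s *: J ->
  sqnorm p = 1 -> sqnorm q = 1 -> `|wedge p q| = 1 ->
  overlap (E *m Z p) (E *m Z q) = `|s| ^+ 2.
Proof.
move=> EE sE p1 q1 pq; rewrite /overlap !sqnorm_iso // !sqnorm_veronese p1 q1.
rewrite dotmx_mul sE -scalemxAl /dotmx -scalemxAr mxE -/(dotmx _ _).
by rewrite dot_antidiag normrM normrX pq !expr1n !mulr1 divr1.
Qed.

Definition north : 'cV[C]_2 := delta_mx 0 0.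
Definition south : 'cV[C]_2 := delta_mx 1 0.

(** Evaluation at two fixed points, so that continuity in the sphere is clear
    while the comparison with |s|^2 is a computation. *)
Definition invariant {n} (f : CP 1 -> CP n) : R :=
  complex.Re (overlap (hvec (f (proj north))) (hvec (f (proj south)))).

Lemma sqnorm_neq0 n (v : 'cV[C]_n) : sqnorm v = 1 -> v != 0.
Proof. by move=> v1; rewrite -sqnorm_eq0 v1 oner_eq0. Qed.

Lemma polesP : [/\ sqnorm north = 1, sqnorm south = 1 & wedge north south = 1].
Proof.
rewrite /sqnorm /wedge !big2 !mxE /= normr0 normr1 expr0n expr1n mulr0 mulr1.
by rewrite addr0 add0r subr0.
Qed.

Lemma wedge_mul (U : 'M[C]_2) p q :
  wedge (U *m p) (U *m q) = \det U * wedge p q.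
Proof.
rewrite (expand_det_row _ 0) big2 /cofactor !det_mx11 !mxE /wedge !mxE !big2 /=.
have -> : lift 0 0 = 1 :> 'I_2 by exact: val_inj.
have -> : lift 1 0 = 0 :> 'I_2 by exact: val_inj.
by ring.
Qed.

(** A reparametrization U in SU(2) preserves orthonormality of p, q and the
    determinant p /\ q; a real orthogonal map preserves the overlap. *)
Lemma overlap_congruent n (E : 'M[C]_(n.+1, 3)) s g (p q : 'cV[C]_2) :
  E^t* *m E = 1%:M -> E^T *m E = s *: J ->
  congruent (projmap E \o veronese R 2) g ->
  sqnorm p = 1 -> sqnorm q = 1 -> `|wedge p q| = 1 ->
  overlap (hvec (g (proj p))) (hvec (g (proj q))) = `|s| ^+ 2.
Proof.
move=> EE sE [A [U [AA /unitarymxP UU dU gE]]] p1 q1 pq.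
have UU' : U^t* *m U = 1%:M by exact: mulmx1C.
have gv v : sqnorm v = 1 ->
    g (proj v) = proj (complexify A *m (E *m Z (U *m v))).
  move=> /sqnorm_neq0 v0; have Uv0 := iso_neq0 UU' v0.
  have ZU0 := veronese_vec_neq0 2 Uv0; have E0 := iso_neq0 EE ZU0.
  rewrite gE /= projmap_proj // veronese_proj // !projmap_proj //.
  exact: iso_neq0 (complexify_iso AA) E0.
have nz v : sqnorm v = 1 -> complexify A *m (E *m Z (U *m v)) != 0.
  move=> /sqnorm_neq0 v0; apply: (iso_neq0 (complexify_iso AA)).
  exact/(iso_neq0 EE)/veronese_vec_neq0/(iso_neq0 UU').
rewrite (gv p) // (gv q) // overlap_hvec; [|exact: nz..].
rewrite (overlap_orth _ _ AA) (overlap_sphere EE sE) ?(sqnorm_iso _ UU') //.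
by rewrite wedge_mul dU mul1r.
Qed.

Lemma invariant_congruent n (E : 'M[C]_(n.+1, 3)) s g :
  E^t* *m E = 1%:M -> E^T *m E = s *: J ->
  congruent (projmap E \o veronese R 2) g -> (invariant g)%:C%C = `|s| ^+ 2.
Proof.
move=> EE sE Eg; have [n1 s1 ns] := polesP.
rewrite /invariant (overlap_congruent EE sE Eg n1 s1); last first.
  by rewrite ns normr1.
by rewrite RRe_real // realX // normr_real.
Qed.

End Invariant.

(** * Explicit spheres *)

Section Witness.
Variable R : realType.
Local Notation C := (Cplx R).
Local Notation CP n := (projective_space R n).
Local Notation J := (@antidiag R).

(** A unitary square root K of J, in the sense that K^T K = J: its rows are
    the linear forms that turn the quadratic form 2 x0 x2 - x1^2 into a sum of
    three squares. *)
Definition standard_conic : 'M[C]_3 :=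
  let r := (sqrtC 2)^-1 in
  \matrix_(i < 3, j < 3)
    nth 0 (nth [::] [:: [:: r; 0; r];
                        [:: 'i * r; 0; - ('i * r)];
                        [:: 0; 'i; 0]] i) j.

Local Notation K := standard_conic.

Lemma standard_conicP : K^t* *m K = 1%:M /\ K^T *m K = J.
Proof.
have r2 : (sqrtC 2)^-1 ^+ 2 = 2^-1 :> C by rewrite exprVn sqrtCK.
have hh : 2 * 2^-1 = 1 :> C by rewrite divff // pnatr_eq0.
have rc : ((sqrtC 2)^-1)^* = (sqrtC 2)^-1 :> C.
  by apply: conj_Creal; rewrite rpredV ger0_real // sqrtC_ge0.
rewrite /K; move: (sqrtC 2)^-1 2^-1 r2 hh rc => r h r2 hh rc.
have ii := @sqrCi C; have ci := @conjCi C.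
split; apply/matrixP => i j; rewrite !mxE big3 !mxE;
  case: i => [[|[|[|//]]] ?]; case: j => [[|[|[|//]]] ?];
  rewrite /= ?rmorphN ?rmorphM ?rmorph0 /= ?rc ?ci; move: ('i) ii => im ii;
  by first [ring: r2 ii
    | rewrite -[RHS]mulr1 -[X in _ = _ * X]hh; ring: r2 ii].
Qed.

(** Stacking a K on i b K adds up hermitian Gram matrices with weights a^2,
    b^2, and bilinear ones with weights a^2, - b^2. *)
Definition conic_family (a b : R) : 'M[C]_(3 + 3, 3) :=
  col_mx (a%:C%C *: K) (('i * b%:C%C) *: K).

Lemma conic_familyP (a b : R) : a ^+ 2 + b ^+ 2 = 1 ->
  (conic_family a b)^t* *m conic_family a b = 1%:M /\
  (conic_family a b)^T *m conic_family a b = (a ^+ 2 - b ^+ 2)%:C%C *: J.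
Proof.
move=> ab; have [KK KJ] := standard_conicP; have ii := @sqrCi C.
have ac (x : R) : (x%:C%C : C)^* = x%:C%C by rewrite conjCE /= oppr0.
have mulZ (x y : C) (M N : 'M[C]_3) :
    (x *: M) *m (y *: N) = (x * y) *: (M *m N).
  by rewrite -scalemxAl -scalemxAr scalerA.
have trZ (x : C) (M : 'M[C]_3) : (x *: M)^T = x *: M^T by rewrite linearZ.
split; rewrite tr_col_mx ?map_row_mx mul_row_col.
- rewrite !tconjZ !mulZ KK -scalerDl (rmorphM Num.Def.conjC 'i) /= conjCi !ac.
  rewrite (_ : _ + _ = (a ^+ 2 + b ^+ 2)%:C%C); first by rewrite ab scale1r.
  rewrite rmorphD !rmorphXn /=; move: ('i) ii => im ii; ring: ii.
- rewrite !trZ !mulZ KJ -scalerDl; congr (_ *: _).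
  rewrite rmorphB !rmorphXn /=; move: ('i) ii => im ii; ring: ii.
Qed.

End Witness.

(** * Topology of projective space *)

Section Topology.
Variable R : realType.
Local Notation C := (Cplx R).
Local Notation CP n := (projective_space R n).

(** Entrywise convergence suffices because there are finitely many entries. *)
Lemma cvg_mx (T : Type) (F : set_system T) (FF : Filter F) m n
    (f : T -> 'M[C]_(m, n)) (M : 'M[C]_(m, n)) :
  (forall i j, f t i j @[t --> F] --> M i j) -> f t @[t --> F] --> M.
Proof.
move=> fM A [P MP PA].
apply: (filterS (P := [set t | forall i j, P i j (f t i j)])).
  by move=> t; exact: PA.
apply: filter_forall => i; apply: filter_forall => j; exact: fM (MP i j).
Qed.

Section Calculus.
Context (T : Type) (F : set_system T) {FF : Filter F}.

Lemma cvg_eqfun (U : topologicalType) (f g : T -> U) (x : U) :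
  g =1 f -> f @ F --> x -> g @ F --> x.
Proof. by move=> /boolp.funext ->. Qed.

Lemma cvg_sum_fin n (f : 'I_n -> T -> C) (a : 'I_n -> C) :
  (forall i, f i t @[t --> F] --> a i) ->
  \sum_i f i t @[t --> F] --> \sum_i a i.
Proof.
by move=> fa; apply: cvg_big => [|i _]; [exact: add_continuous|exact: fa].
Qed.

Lemma cvg_entry m n (f : T -> 'M[C]_(m, n)) (M : 'M[C]_(m, n)) i j :
  f @ F --> M -> f t i j @[t --> F] --> M i j.
Proof.
move=> fM; apply: (cvg_comp f (fun N : 'M[C]_(m, n) => N i j) fM).
exact: coord_continuous.
Qed.

Lemma cvg_pow (f : T -> C) (a : C) k :
  f @ F --> a -> f t ^+ k @[t --> F] --> a ^+ k.
Proof.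
move=> fa; elim: k => [|k IH].
  by rewrite expr0; exact: cvg_cst.
rewrite exprS; apply: (cvg_eqfun (f := fun t => f t * f t ^+ k)) => [t|].
  exact: exprS.
exact: (cvgM fa IH).
Qed.

Lemma cvg_mulmx l m n (f : T -> 'M[C]_(l, m)) (g : T -> 'M[C]_(m, n))
    (M : 'M[C]_(l, m)) (N : 'M[C]_(m, n)) :
  f @ F --> M -> g @ F --> N -> f t *m g t @[t --> F] --> M *m N.
Proof.
move=> fM gN; apply: cvg_mx => i j.
have e t : (f t *m g t) i j = \sum_k f t i k * g t k j by rewrite mxE.
rewrite (mxE _ _ i j).
apply: (@cvg_eqfun C _ _ _ e).
apply: cvg_sum_fin => k; apply: cvgM; exact: cvg_entry.
Qed.

Lemma cvg_sqnorm n (f : T -> 'cV[C]_n) (v : 'cV[C]_n) :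
  f @ F --> v -> sqnorm (f t) @[t --> F] --> sqnorm v.
Proof.
move=> fv; apply: cvg_sum_fin => i.
by apply: cvg_pow; apply: cvg_norm; exact: cvg_entry.
Qed.

Lemma cvg_overlap n (f g : T -> 'cV[C]_n) (v w : 'cV[C]_n) :
  f @ F --> v -> g @ F --> w ->
  v != 0 -> w != 0 -> overlap (f t) (g t) @[t --> F] --> overlap v w.
Proof.
move=> fv gw v0 w0; apply: cvgM.
  apply: cvg_pow; apply: cvg_norm.
  apply: (cvg_eqfun (fun t => dotmxE (f t) (g t))).
  by rewrite dotmxE; apply: cvg_sum_fin => i; apply: cvgM; exact: cvg_entry.
apply: cvgV; first by rewrite mulf_neq0 // sqnorm_eq0.
by apply: cvgM; exact: cvg_sqnorm.
Qed.

Lemma cvg_veronese_vec d (f : T -> 'cV[C]_2) (w : 'cV[C]_2) :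
  f @ F --> w -> veronese_vec d (f t) @[t --> F] --> veronese_vec d w.
Proof.
move=> fw; apply: cvg_mx => i j.
apply: (cvg_eqfun (f := fun t =>
  sqrtC 'C(d, i)%:R * f t 0 0 ^+ (d - i) * f t 1 0 ^+ i)) => [t|].
  exact: mxE.
rewrite mxE; apply: cvgM; last by apply: cvg_pow; exact: cvg_entry.
by apply: cvgM; [exact: cvg_cst|apply: cvg_pow; exact: cvg_entry].
Qed.

End Calculus.

Lemma Re_continuous : continuous (@complex.Re R : C -> R).
Proof.
move=> z A /nbhs_ballP[e e0 eA]; apply/nbhs_ballP; exists e%:C%C => /=.
  by rewrite ltcR.
move=> w zw; apply: eA; rewrite /ball /= -ltcR.
apply: le_lt_trans zw; rewrite -ReB; exact: normc_ge_Re.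
Qed.

(** The radii of balls in the complex numbers are complex numbers, positive
    and hence real. *)
Lemma real_complex_continuous : continuous (real_complex R : R -> C).
Proof.
move=> x A /nbhs_ballP[e e0 eA]; apply/nbhs_ballP.
have [e1 /= e10 ee] : exists2 e1 : R, 0 < e1 & e = e1%:C%C.
  exists (complex.Re e); last by rewrite RRe_real // gtr0_real.
  by move: e0; rewrite /= ltcE => /andP[].
exists e1 => // y xy; apply: eA; rewrite /ball /= ee -rmorphB.
have -> : `|(x - y)%:C%C : C| = `|x - y|%:C%C.
  by rewrite normc_def /= expr0n addr0 sqrtr_sqr.
by rewrite ltcR.
Qed.

Lemma near_neq0 n (v : 'cV[C]_n) : v != 0 -> \forall w \near v, w != 0.
Proof.
move=> v0; near do rewrite -sqnorm_eq0.
by apply: (cvgr_neq0 (sqnorm v)); [exact: cvg_sqnorm|rewrite sqnorm_eq0].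
Unshelve. all: by end_near. Qed.

(** Transports the quotient topology from the subtype of nonzero vectors to
    the whole vector space, where continuity can be computed. *)
Lemma open_proj n (O : set (CP n)) :
  open O <-> open [set v | v != 0 /\ O (proj v)].
Proof.
have -> : open O = open ((\pi_(CP n) : punctured -> CP n) @^-1` O) by [].
split=> [[U oU UO]|oO].
- rewrite (_ : [set v | _] = [set v | v != 0] `&` U); last first.
    apply/seteqP; split=> v [v0 vO]; split=> //.
    + have vP : v \in punctured by exact/mem_set.
      have : ((\pi_(CP n) : punctured -> CP n) @^-1` O) (insubd ones v).
        exact: vO.
      by rewrite -UO /= /set_val /= insubdK.
    + have vP : v \in punctured by exact/mem_set.
      have : ((set_val : punctured -> _) @^-1` U) (insubd ones v).
        by rewrite /= /set_val /= insubdK.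
      by rewrite UO.
  by apply: openI => //; rewrite openE => v; exact: near_neq0.
- exists [set v | v != 0 /\ O (proj v)] => //.
  apply/seteqP; split=> v /=; rewrite /set_val /= /proj valKd; first by case.
  by split=> //; have /set_mem := valP v.
Qed.

Lemma proj_continuous n (v : 'cV[C]_n.+1) : v != 0 ->
  {for v, continuous (proj : 'cV[C]_n.+1 -> CP n)}.
Proof.
move=> v0 A; rewrite nbhsE => -[B [/open_proj oO Ov] OA].
apply: (filterS (P := [set w | w != 0 /\ B (proj w)])).
  by move=> w [_ /OA].
exact: open_nbhs_nbhs.
Qed.

(** The projection is open: the saturation of an open set is the union of its
    nonzero multiples. Together with continuity this allows continuity of a
    function on a product with a projective space to be checked on homogeneous
    coordinates, although a product of quotient maps need not be one in
    general. *)
Lemma nbhs_proj n (v : 'cV[C]_n.+1) (A : set 'cV[C]_n.+1) : v != 0 ->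
  nbhs v A -> nbhs (proj v : CP n) (proj @` A).
Proof.
move=> v0; rewrite nbhsE => -[B [oO Ov] OA].
apply: (filterS (P := proj @` (B `&` [set w | w != 0]))).
  by move=> _ [w [/OA Aw _] <-]; exists w.
apply: open_nbhs_nbhs; split; last by exists v.
apply/open_proj.
rewrite (_ : [set _ | _] = \bigcup_(c in [set c : C | c != 0])
    ((fun w => c *: w) @^-1` (B `&` [set w | w != 0]))).
  apply: bigcup_open => c c0; apply: open_comp.
    by move=> w _; exact: scaler_continuous.
  by apply: openI => //; rewrite openE => w; exact: near_neq0.
apply/seteqP; split=> [w [w0 [u [Ou u0] uw]]|w [c /= c0 [Ow cw0]]].
- have [c c0 cE] := hvec_proj u0; have [b b0 bE] := hvec_proj w0.
  exists (c^-1 * b); first by rewrite /= mulf_neq0 ?invr_eq0.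
  suff cbw : (c^-1 * b) *: w = u by rewrite /preimage /= cbw.
  by rewrite -scalerA -bE -uw cE scalerA mulVf ?scale1r.
- have w0 : w != 0 by apply: contraNneq cw0 => ->; rewrite scaler0.
  by split=> //; exists (c *: w) => //; rewrite proj_scale.
Qed.

End Topology.

(** * Moduli spaces *)

Section Moduli.
Variable R : realType.
Local Notation C := (Cplx R).
Local Notation CP n := (projective_space R n).

Lemma eval_continuous (X Y : topologicalType) (x : X) :
  continuous (fun f : {compact-open, X -> Y} => f x).
Proof.
move=> f A; rewrite nbhsE => -[B [oB Bfx] BA].
apply: (filterS (P := [set g : {compact-open, X -> Y} | g @` [set x] `<=` B])).
  by move=> g gB; apply/BA/gB; exists x.
apply: open_nbhs_nbhs; split.
  by apply: compact_open_open => //; exact: compact_set1.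
by move=> _ [_ -> <-].
Qed.

Lemma overlap_continuous n :
  continuous (fun pq : CP n * CP n => overlap (hvec pq.1) (hvec pq.2)).
Proof.
move=> [p q] A /=; rewrite -(Defs.projK p) -(Defs.projK q).
have := hvec_neq0 p; have := hvec_neq0 q; move: (hvec p) (hvec q) => v w w0 v0.
rewrite overlap_hvec // => nA.
have [[V W] [/= nV nW] VWA] : nbhs (v, w)
    ((fun vw : 'cV[C]_n.+1 * 'cV[C]_n.+1 => overlap vw.1 vw.2) @^-1` A).
  exact: (cvg_overlap (F := nbhs (v, w)) cvg_fst cvg_snd v0 w0 nA).
exists (proj @` (V `&` [set v | v != 0]), proj @` (W `&` [set v | v != 0])).
  by split; apply: nbhs_proj => //; apply: filterI => //; exact: near_neq0.
move=> [_ _] [/= [v' [Vv' v'0] <-] [w' [Ww' w'0] <-]].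
by rewrite overlap_hvec //; exact: (VWA (v', w')).
Qed.

Lemma invariant_continuous n :
  continuous (@invariant R n : {compact-open, CP 1 -> CP n} -> R).
Proof.
pose ev (g : {compact-open, CP 1 -> CP n}) :=
  (g (proj (north R)), g (proj (south R))).
move=> f.
have cn := @eval_continuous (CP 1) (CP n) (proj (north R)) f.
have cs := @eval_continuous (CP 1) (CP n) (proj (south R)) f.
have cev : {for f, continuous ev} by exact: (cvg_pair cn cs).
have co := continuous_comp cev (@overlap_continuous n (ev f)).
exact: (continuous_comp co (@Re_continuous R _)).
Qed.

(** Currying sends jointly continuous maps to continuous maps for the
    compact-open topology; joint continuity is checked on homogeneous
    coordinates. *)
Lemma sphere_family_continuous (T : topologicalType) n
    (E : T -> 'M[C]_(n.+1, 3)) :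
  (forall i j, continuous (fun t => E t i j)) ->
  (forall t, (E t)^t* *m E t = 1%:M) ->
  continuous (fun t => projmap (E t) \o veronese R 2 :
    {compact-open, CP 1 -> CP n}).
Proof.
move=> cE EE.
pose F (tp : T * CP 1) := projmap (E tp.1) (veronese R 2 tp.2).
apply: (@continuous_curry_fun _ _ _ F) => -[t p] A /=.
have FE u (w : 'cV[C]_2) : w != 0 ->
    F (u, proj w) = proj (E u *m veronese_vec 2 w).
  move=> w0; rewrite /F /= veronese_proj // projmap_proj //.
  exact/(iso_neq0 (EE u))/veronese_vec_neq0.
rewrite -(Defs.projK p); have := hvec_neq0 p; move: (hvec p) => w w0.
rewrite FE // => nA.
pose G (uw : T * 'cV[C]_2) := E uw.1 *m veronese_vec 2 uw.2.
have cG : {for (t, w), continuous G}.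
  apply: cvg_mulmx; last by apply: cvg_veronese_vec; exact: cvg_snd.
  apply: cvg_mx => i j.
  exact: (continuous_comp (f := fst) (x := (t, w)) cvg_fst (cE i j t)).
have G0 : G (t, w) != 0 by exact/(iso_neq0 (EE t))/veronese_vec_neq0.
have [[U W] [/= nU nW] UWA] := continuous_comp cG (proj_continuous G0) nA.
exists (U, proj @` (W `&` [set v | v != 0])).
  by split=> //; apply: nbhs_proj => //; apply: filterI => //; exact: near_neq0.
move=> [u _] [/= Uu [w' [Ww' w'0] <-]]; rewrite FE //; exact: (UWA (u, w')).
Qed.

Lemma norm_sqr_inj (s t : C) : `|s| ^+ 2 = `|t| ^+ 2 -> `|s| = `|t|.
Proof. by move/eqP; rewrite eqrXn2 // => /eqP. Qed.

Lemma sphere_gram n (f : spheres R 2 n) :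
  exists E : 'M[C]_(n.+1, 3), exists s : C,
    [/\ E^t* *m E = 1%:M, E^T *m E = s *: antidiag R,
        val f = projmap E \o veronese R 2 &
        (invariant (val f))%:C%C = `|s| ^+ 2].
Proof.
have /spheresP[E [s [EE sE fE]]] : spheres R 2 n (val f).
  exact: set_mem (valP f).
exists E, s; split=> //; apply: (invariant_congruent EE sE).
by rewrite fE; exact: congruent_refl.
Qed.

Lemma sphere_invariant_itv n (f : spheres R 2 n) : 0 <= invariant (val f) <= 1.
Proof.
have [E [s [EE sE _ fs]]] := sphere_gram f; move: fs.
move: (invariant _) => r rE; have s1 := gram_param_le1 EE sE.
by rewrite -!lecR rE exprn_ge0 // exprn_ile1.
Qed.

Lemma sphere_invariant1 n (f : spheres R 2 n) :
  (n < 5)%N -> invariant (val f) = 1.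
Proof.
move=> n5; have [E [s [EE sE _ fs]]] := sphere_gram f; apply: complexI.
by apply: (etrans fs); rewrite (gram_param_norm1 n5 EE sE) expr1n.
Qed.

(** Both sides say that the parameters s of the two spheres have the same
    modulus. *)
Lemma sphere_congruent n (f g : spheres R 2 n) :
  congruent (val f) (val g) <-> invariant (val f) = invariant (val g).
Proof.
have [E [s [EE sE fE fs]]] := sphere_gram f.
have [F [t [FF tF gF gt]]] := sphere_gram g.
split=> fg.
  apply: complexI; apply: (etrans fs); apply/esym/(invariant_congruent EE sE).
  by move: fg; rewrite fE.
have st : `|s| = `|t|.
  apply: norm_sqr_inj.
  exact: etrans (esym fs) (etrans (congr1 (real_complex R) fg) gt).
rewrite fE gF.
exact: (congruent_gram EE sE FF tF st).
Qed.

Definition moduli_invariant n (x : moduli R 2 n) : R :=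
  invariant (val (repr x)).

Lemma moduli_invariant_pi n (f : spheres R 2 n) :
  moduli_invariant (\pi_(moduli R 2 n) f) = invariant (val f).
Proof.
apply: (sphere_congruent _ f).1.
have /eqmodP/asboolP :
    repr (\pi_(moduli R 2 n) f) = f %[mod {eq_quot @congruentb R 2 n}].
  exact: reprK.
by [].
Qed.

Lemma moduli_invariant_inj n : injective (@moduli_invariant n).
Proof.
move=> x y xy; rewrite -(reprK x) -(reprK y); apply/eqmodP/asboolP.
exact: (sphere_congruent _ _).2 xy.
Qed.

Lemma moduli_invariant_continuous n : continuous (@moduli_invariant n).
Proof.
pose inv (f : spheres R 2 n) : R := invariant (val f).
have cinv : continuous inv.
  move=> f; apply: (@continuous_comp _ {compact-open, CP 1 -> CP n} _
    (fun f : spheres R 2 n => val f) (@invariant R n)).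
    exact: initial_continuous.
  exact: invariant_continuous.
apply: (repr_comp_continuous cinv) => f g /eqP fg; apply/eqP.
have /(congr1 (@moduli_invariant n)) :
    \pi_(moduli R 2 n) f = \pi_(moduli R 2 n) g.
  exact: fg.
by rewrite !moduli_invariant_pi.
Qed.

Lemma moduli_subsingleton n (x y : moduli R 2 n) : (n < 5)%N -> x = y.
Proof.
move=> n5; apply: moduli_invariant_inj.
exact: etrans (sphere_invariant1 _ n5) (esym (sphere_invariant1 _ n5)).
Qed.

Lemma subsingleton_homeomorphism (X Y : topologicalType) (f : X -> Y) (x0 : X) :
  (forall x y : X, x = y) -> (forall x y : Y, x = y) -> homeomorphism f.
Proof.
move=> Xs Ys; split.
  rewrite (_ : f = cst (f x0)); first exact: cst_continuous.
  by apply: boolp.funext => x; exact: Ys.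
exists (fun=> x0); split=> [|x|y]; [exact: cst_continuous|exact: Xs|exact: Ys].
Qed.

Lemma conic_sphere : spheres R 2 2 (projmap (standard_conic R) \o veronese R 2).
Proof.
apply/spheresP; exists (standard_conic R), 1.
by have [KK KJ] := standard_conicP R; rewrite scale1r.
Qed.

Local Notation I := ([set x : R | 0 <= x <= 1]).

(** Chosen so that the squares of the two coefficients add up to 1 and their
    difference is sqrt t, which makes the invariant t. *)
Definition path_re (t : R) : R := Num.sqrt ((1 + Num.sqrt t) / 2).
Definition path_im (t : R) : R := Num.sqrt ((1 - Num.sqrt t) / 2).

Definition conic_path (t : R) : 'M[C]_(6, 3) :=
  conic_family (path_re t) (path_im t).

Lemma conic_pathP (t : R) : 0 <= t <= 1 ->
  (conic_path t)^t* *m conic_path t = 1%:M /\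
  (conic_path t)^T *m conic_path t = (Num.sqrt t)%:C%C *: antidiag R.
Proof.
move=> /andP[t0 t1].
have s1 : Num.sqrt t <= 1 by rewrite -sqrtr1 ler_sqrt.
have s0 := sqrtr_ge0 t.
have aE : path_re t ^+ 2 = (1 + Num.sqrt t) / 2 by rewrite sqr_sqrtr //; lra.
have bE : path_im t ^+ 2 = (1 - Num.sqrt t) / 2 by rewrite sqr_sqrtr //; lra.
have [|EE sE] := @conic_familyP R (path_re t) (path_im t).
  by rewrite aE bE; lra.
split; first exact: EE.
rewrite [LHS]sE; congr (_%:C%C *: _).
by rewrite aE bE; lra.
Qed.

Lemma conic_path_continuous i j : continuous (fun t => conic_path t i j).
Proof.
have sq (g : R -> R) : continuous g ->
    continuous (fun t => (Num.sqrt (g t))%:C%C : C).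
  move=> cg t; have cs := continuous_comp (cg t) (@sqrt_continuous R _).
  exact: (continuous_comp cs (@real_complex_continuous R _)).
have ca : continuous (fun t => (path_re t)%:C%C : C).
  apply: sq => t; apply: cvgM; last exact: cvg_cst.
  by apply: cvgD; [exact: cvg_cst|exact: sqrt_continuous].
have cb : continuous (fun t => (path_im t)%:C%C : C).
  apply: sq => t; apply: cvgM; last exact: cvg_cst.
  by apply: cvgB; [exact: cvg_cst|exact: sqrt_continuous].
move=> t.
pose K := standard_conic R.
have E u : conic_path u i j = match fintype.split (i : 'I_(3 + 3)) with
    | inl k => (path_re u)%:C%C * K k j
    | inr k => 'i * (path_im u)%:C%C * K k j end.
  by rewrite [LHS]mxE; case: fintype.split => k; rewrite mxE.
rewrite /continuous_at (E t); apply: (cvg_eqfun E).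
case: (fintype.split (i : 'I_(3 + 3))) => k.
  by apply: cvgM; [exact: ca|exact: cvg_cst].
by apply: cvgM; [apply: cvgM; [exact: cvg_cst|exact: cb]|exact: cvg_cst].
Qed.

Lemma conic_path_spheres t : 0 <= t <= 1 ->
  spheres R 2 5 (projmap (conic_path t) \o veronese R 2) /\
  invariant (projmap (conic_path t) \o veronese R 2) = t.
Proof.
move=> t01; have [EE sE] := conic_pathP t01; split.
  by apply/spheresP; exists (conic_path t), (Num.sqrt t)%:C%C.
apply: complexI; rewrite (invariant_congruent EE sE (congruent_refl _)).
have /andP[t0 _] := t01.
by rewrite ger0_norm ?lecR ?sqrtr_ge0 // -rmorphXn sqr_sqrtr.
Qed.

(** The inverse of the invariant sends t to the class of the explicit sphere. *)
Lemma moduli_itv_homeomorphic : homeomorphic (moduli R 2 5) I.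
Proof.
have bound (x : moduli R 2 5) : moduli_invariant x \in I.
  by apply/mem_set; exact: sphere_invariant_itv.
pose path (t : I) : spheres R 2 5 :=
  exist (fun g => g \in spheres R 2 5) _
    (mem_set (conic_path_spheres (set_mem (valP t))).1).
exists (fun x => exist (fun t => t \in I) _ (bound x)); split.
  apply: continuous_comp_initial; exact: moduli_invariant_continuous.
exists (fun t => \pi_(moduli R 2 5) (path t)); split.
- move=> t; apply: (continuous_comp (f := path)); last exact: pi_continuous.
  apply: continuous_comp_initial => {}t.
  have cI : continuous (fun u : I =>
      projmap (conic_path (val u)) \o veronese R 2 :
      {compact-open, CP 1 -> CP 5}).
    apply: sphere_family_continuous => [i j u|u].
      apply: (@continuous_comp _ _ _ (fun u : I => val u)
        (fun t => conic_path t i j)).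
        exact: initial_continuous.
      exact: conic_path_continuous.
    by have [] := conic_pathP (set_mem (valP u)).
  exact: cI.
- move=> x; apply: moduli_invariant_inj; rewrite moduli_invariant_pi.
  by have [_] := conic_path_spheres (set_mem (bound x)).
- move=> t; apply: val_inj; rewrite /= moduli_invariant_pi.
  by have [_] := conic_path_spheres (set_mem (valP t)).
Qed.

End Moduli.

Theorem theorem6p1 (R : realType) :
  [/\ exists x : moduli R 2 2, forall y : moduli R 2 2, y = x,
      homeomorphism (moduli_incl R 2 2 : moduli R 2 2 -> moduli R 2 3),
      homeomorphism (moduli_incl R 2 3 : moduli R 2 3 -> moduli R 2 4) &
      homeomorphic (moduli R 2 5) [set x : R | 0 <= x <= 1]].
Proof.
pose f : spheres R 2 2 :=
  exist (fun g => g \in spheres R 2 2) _ (mem_set (conic_sphere R)).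
pose x := \pi_(moduli R 2 2) f.
have low n (n5 : (n < 5)%N) (y z : moduli R 2 n) : y = z.
  exact: moduli_subsingleton.
split.
- by exists x => y; exact: low.
- by apply: (@subsingleton_homeomorphism (moduli R 2 2) (moduli R 2 3) _ x);
    exact: low.
- by apply: (@subsingleton_homeomorphism (moduli R 2 3) (moduli R 2 4) _
    (moduli_incl R 2 2 x)); exact: low.
- exact: moduli_itv_homeomorphic.
Qed.
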